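(* Let $X$ be a compact metric $Z_2$-space with $\operatorname{ind}X=n$, covered by closed sets $U_1,\dots,U_{n+2}$ none of which contains a pair of antipodal points $x,\sigma(x)$. Then for every partition of $\{U_1,\dots,U_{n+2}\}$ into non-empty subfamilies $\mathcal F_1,\mathcal F_2$ there exists $x\in X$ with $x\in\bigcap\mathcal F_1$ and $\sigma(x)\in\bigcap\mathcal F_2$. Moreover, if there is a closed covering $V_1,\dots,V_{n+2}$ of $B(X)$ with $U_i=i_X^{-1}(V_i)$ for all $i$, then $V_1,\dots,V_{n+2}$ have a common point.
   Context: $Z_2=\{1,\sigma\}$ acts continuously on $X$; points $x$ and $\sigma(x)$ are called antipodal. Cohomology is Čech cohomology with $Z_2$ coefficients; $w\in H^1_{Z_2}(X;Z_2)=H^1(X\times_{Z_2}EZ_2;Z_2)$ is the pullback of the generator of $H^*(\mathbb RP^\infty;Z_2)=Z_2[w]$, and $\operatorname{ind}X$ is the largest $n$ with $w^n\ne0$ ($\infty$ if none). For a free $Z_2$-space $X$, $B(X)=(X\times[0,1])/Z_2$ with $\sigma(x,t)=(\sigma(x),1-t)$, and $i_X:X\to B(X)$, $x\mapsto[(x,0)]$. *)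

(* Defs.v *)
From HB Require Import structures.
From mathcomp Require Import all_boot all_order all_algebra.
From mathcomp Require Import generic_quotient.
From mathcomp Require Import all_classical all_reals all_analysis.
Set Implicit Arguments.
Unset Strict Implicit.
Unset Printing Implicit Defensive.
Import Order.TTheory GRing.Theory Num.Theory numFieldNormedType.Exports.
Local Open Scope classical_set_scope.
Local Open Scope ring_scope.
Local Open Scope quotient_scope.

(* Orbit space of the Z_2-action generated by an involution s, with the       *)
(* quotient topology. Comparing the orbits {x, s x} as sets makes the         *)
(* relation an equivalence without using that s is an involution.             *)
Section OrbitSpace.
Context {T : topologicalType} (s : T -> T).

Definition orbit_rel : rel T :=
  fun x y => `[< [set x; s x] = [set y; s y] >].

Lemma orbit_rel_equiv : equiv_class_of orbit_rel.
Proof.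
split=> [x|x y|y x z].
- exact/asboolP.
- by apply/asboolP/asboolP => ->.
- by move=> /asboolP xy /asboolP yz; apply/asboolP; rewrite xy.
Qed.

Canonical orbit_equiv := EquivRelPack orbit_rel_equiv.

Definition orbit_space : topologicalType :=
  quotient_topology {eq_quot orbit_equiv}.

Definition orbit_proj (x : T) : orbit_space :=
  \pi_{eq_quot orbit_equiv} x.

Definition orbit_repr (q : orbit_space) : T :=
  repr (q : {eq_quot orbit_equiv}).

Lemma orbit_projP (x y : T) :
  orbit_proj x = orbit_proj y <-> [set x; s x] = [set y; s y].
Proof.
split=> [/eqmodP/asboolP // | h].
by apply/eqmodP/asboolP.
Qed.

Lemma orbit_reprK (q : orbit_space) : orbit_proj (orbit_repr q) = q.
Proof. exact: (reprK (q : {eq_quot orbit_equiv})). Qed.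

End OrbitSpace.

(* Cech cohomology with coefficients in Z_2 = 'F_2: the direct limit, over    *)
(* the open coverings ordered by refinement, of the simplicial cohomology of  *)
(* their nerves.                                                              *)
Section Cech.

Record open_cover (Y : topologicalType) := OpenCover {
  cover_index : Type;
  cover_set :> cover_index -> set Y;
  cover_open : forall i, open (cover_set i);
  cover_full : \bigcup_i cover_set i = setT }.

Context {Y : topologicalType}.

Definition nerve_simplex (U : open_cover Y) p (s : 'I_p.+1 -> cover_index U) :=
  (\bigcap_i U (s i)) !=set0.

(* Only the values on tuples satisfying nerve_simplex are meaningful: every   *)
(* equation between cochains below is imposed on those tuples only.           *)
Definition cochain (U : open_cover Y) p := ('I_p.+1 -> cover_index U) -> 'F_2.

Definition coboundary U p (f : cochain U p) : cochain U p.+1 :=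
  fun s => \sum_(j < p.+2) f (s \o lift j).

Definition cocycle U p (f : cochain U p) :=
  forall s, nerve_simplex s -> coboundary f s = 0.

Definition is_coboundary U p : cochain U p -> Prop :=
  match p with
  | 0%N => fun f => forall s, nerve_simplex s -> f s = 0
  | q.+1 => fun f => exists g : cochain U q,
      forall s, nerve_simplex s -> f s = coboundary g s
  end.

Definition refinement (W U : open_cover Y)
    (r : cover_index W -> cover_index U) :=
  forall i, W i `<=` U (r i).

Definition restrict (W U : open_cover Y) (r : cover_index W -> cover_index U)
    p (f : cochain U p) : cochain W p := fun s => f (r \o s).

(* Two cocycles, possibly on different coverings, represent the same class.   *)
Definition cohomologous U V p (f : cochain U p) (g : cochain V p) :=
  exists (W : open_cover Y) (r : cover_index W -> cover_index U)
         (t : cover_index W -> cover_index V),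
    [/\ refinement r, refinement t
      & is_coboundary (fun s => restrict r f s - restrict t g s)].

Definition zero_cochain U p : cochain U p := fun=> 0.

Definition scale_cochain U p (a : 'F_2) (f : cochain U p) : cochain U p :=
  fun s => a * f s.

Definition front p q {I : Type} (s : 'I_(p + q).+1 -> I) : 'I_p.+1 -> I :=
  fun i => s (@lshift p.+1 q i).

Definition back p q {I : Type} (s : 'I_(p + q).+1 -> I) : 'I_q.+1 -> I :=
  fun i => s (cast_ord (addnS p q) (rshift p i)).

Definition cup U p q (f : cochain U p) (g : cochain U q) : cochain U (p + q) :=
  fun s => f (front s) * g (back s).

Definition cup_exp U (w : cochain U 1) : forall n, cochain U n :=
  fix exp n : cochain U n :=
    match n with
    | 0%N => fun=> 1
    | m.+1 => cup w (exp m)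
    end.
Arguments cup_exp {U} w n _.

Definition nonzero_class U p (f : cochain U p) :=
  ~ cohomologous f (zero_cochain (U := U) (p := p)).

(* H^*(Y; Z_2) = Z_2[w] with w in degree 1: every class of degree m is a      *)
(* unique multiple of w^m.                                                    *)
Definition polynomial_generator U (w : cochain U 1) :=
  cocycle w /\
  forall m V (c : cochain V m), cocycle c ->
    exists! a : 'F_2, cohomologous c (scale_cochain a (cup_exp w m)).

End Cech.
Arguments cup_exp {Y U} w n _.

Section Pullback.
Context {Y Z : topologicalType} (f : Y -> Z) (cf : continuous f).
Variable U : open_cover Z.

Lemma pull_cover_open i : open (f @^-1` U i).
Proof. by move/continuousP : cf; apply; exact: cover_open. Qed.

Lemma pull_cover_full : \bigcup_i (f @^-1` U i) = setT.
Proof. by rewrite -preimage_bigcup cover_full preimage_setT. Qed.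

Definition pull_cover : open_cover Y := OpenCover pull_cover_open pull_cover_full.

Definition pull_cochain p (c : cochain U p) : cochain pull_cover p := c.

End Pullback.
Arguments pull_cover {Y Z f} cf U.
Arguments pull_cochain {Y Z f} cf {U p} c _.

Section Index.
Context (R : realType).

(* S^oo = unit sphere of the space of finitely supported real sequences. On   *)
(* this sphere coordinatewise convergence is the same as convergence in the   *)
(* Euclidean norm, so this topology is metrizable; S^oo is contractible and   *)
(* the antipodal action on it is free, whence a model of EZ_2 whose orbit     *)
(* space is RP^oo.                                                            *)
Definition sphere_infty : set (prod_topology (fun _ : nat => R)) :=
  [set x | exists N : nat,
     (forall i, (N <= i)%N -> x i = 0) /\ \sum_(i < N) x i ^+ 2 = 1].

Definition EZ2 : topologicalType := set_type sphere_infty.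

Lemma antipode_subproof (x : EZ2) : sphere_infty (fun i => - set_val x i).
Proof.
have [N [x0 x1]] := set_valP x; exists N; split=> [i Ni|].
  by apply/eqP; rewrite oppr_eq0; apply/eqP; exact: x0.
by rewrite -[RHS]x1; apply: eq_bigr => i _; exact: sqrrN.
Qed.

Definition antipode (x : EZ2) : EZ2 := SigSub (mem_set (antipode_subproof x)).

Lemma antipodeK : involutive antipode.
Proof. by move=> x; apply: val_inj; apply/funext => i /=; rewrite opprK. Qed.

Definition RP_infty := orbit_space antipode.

Context {X : topologicalType} (sigma : X -> X).

Definition diag_action (z : X * EZ2) : X * EZ2 := (sigma z.1, antipode z.2).

Definition borel := orbit_space diag_action.

Definition borel_to_RP (q : borel) : RP_infty :=
  orbit_proj antipode (orbit_repr q).2.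

Lemma borel_to_RPE z :
  borel_to_RP (orbit_proj diag_action z) = orbit_proj antipode z.2.
Proof.
apply/orbit_projP; have /orbit_projP := orbit_reprK (orbit_proj diag_action z).
set y := orbit_repr _ => e.
have : [set z; diag_action z] y by rewrite -e; left.
by case=> -> //=; rewrite antipodeK setUC.
Qed.

Lemma borel_to_RP_continuous : continuous borel_to_RP.
Proof.
apply/(quotient_continuous (Q0 := {eq_quot (orbit_equiv diag_action)})).
rewrite (_ : _ \o _ = orbit_proj antipode \o snd); last first.
  by apply/funext => z; exact: borel_to_RPE.
move=> z; apply: continuous_comp; first exact: cvg_snd.
exact: (@pi_continuous _ {eq_quot (orbit_equiv antipode)}).
Qed.

(* ind X = n. The cocycle g represents the generator of H^*(RP^oo) (over Z_2  *)
(* its class is unique), and w is its pullback to the Borel construction.     *)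
Definition index_eq (n : nat) :=
  exists (U : open_cover RP_infty) (g : cochain U 1),
    polynomial_generator g /\
    let w := pull_cochain borel_to_RP_continuous g in
    nonzero_class (cup_exp w n) /\
    (forall m, nonzero_class (cup_exp w m) -> (m <= n)%N).

End Index.

Section CylinderQuotient.
Context (R : realType) {X : topologicalType} (sigma : X -> X).

Definition unit_interval : topologicalType := set_type (`[0, 1]%classic : set R).

Lemma zero_subproof : `[0, 1]%classic (0 : R).
Proof. by rewrite /= in_itv /= lexx ler01. Qed.

Lemma flip_subproof (t : unit_interval) : `[0, 1]%classic (1 - set_val t).
Proof.
have := set_valP t; rewrite /= !in_itv /= => /andP[t0 t1].
by rewrite subr_ge0 t1 gerBl t0.
Qed.

Definition zero_I : unit_interval := SigSub (mem_set zero_subproof).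

Definition flip (t : unit_interval) : unit_interval :=
  SigSub (mem_set (flip_subproof t)).

Definition cyl_action (z : X * unit_interval) : X * unit_interval :=
  (sigma z.1, flip z.2).

Definition BX := orbit_space cyl_action.

Definition iX (x : X) : BX := orbit_proj cyl_action (x, zero_I).

End CylinderQuotient.

(* Main.v *)
Require Import Defs.
From mathcomp Require Import all_boot all_order all_algebra.
From mathcomp Require Import ring lra.
From mathcomp Require Import all_classical all_reals all_analysis.
Set Implicit Arguments.
Unset Strict Implicit.
Unset Printing Implicit Defensive.
Import Order.TTheory GRing.Theory Num.Theory numFieldNormedType.Exports.
Local Open Scope classical_set_scope.
Local Open Scope ring_scope.

(* The power w^n is represented by cup products of coboundaries of odd Z_2-   *)
(* valued labels of the points of X: if chi_1, ..., chi_n satisfy             *)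
(* chi_k (sigma x) = chi_k x + 1, then d chi_1 u ... u d chi_n, evaluated on  *)
(* tuples of nearby points, is sigma-invariant and descends to w^n.           *)
(*                                                                            *)
(* Part 1. Odd functions f_i, positive on U_i and negative on sigma U_i, give *)
(* the n odd functions f_i - f_{i0} (i in F1) and f_j - f_{j0} (j in F2). If  *)
(* the required point does not exist they have no common zero, so the sign    *)
(* labels satisfy d chi_1 u ... u d chi_n = 0.                                *)
(*                                                                            *)
(* Part 2. If the V_i have no common point, functions supported near them     *)
(* give n + 1 functions without common zero on X x [0, 1], odd at t = 0 and   *)
(* even at t = 1/2. Put u_t = chi_0 u d chi_1 u ... u d chi_n for the sign    *)
(* labels chi_k at time t. Then u_0 + sigma u_0 represents w^n, while         *)
(* u_{1/2} + sigma u_{1/2} = 0, and u_t changes by a coboundary when t moves  *)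
(* by a small step; hence w^n = 0.                                            *)

(** Both parts are Borsuk-Ulam arguments carried out on Cech cochains. By [generator_classifies], a
    generator of H^1(RP^oo) becomes, on a fine enough covering, the characteristic cocycle of the
    double covering S^oo -> RP^oo. Comparing the sheet labels of that covering with odd labels on X,
    [index_obstruction] shows that w^n = 0 as soon as d chi_1 u ... u d chi_n is, on tuples of
    nearby points, the coboundary of a sigma-symmetrized cochain; this contradicts ind X = n. Two
    consequences are drawn. [no_odd_map] excludes n odd functions on X without common zero.
    [no_half_homotopy] excludes n + 1 functions without common zero on X x [0, 1] that are odd at
    time 0 and even at time 1/2. In [partition_point] and [common_point], a failure of the
    conclusion gives, by compactness, a uniform gap [eps], from which truncated distances to the
    closed sets produce such forbidden functions. *)

Lemma addF2 (x : 'F_2) : x + x = 0.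
Proof. by case: x => [[|[|//]]] ?; apply/val_inj. Qed.

Lemma two0 : 2%:R = 0 :> 'F_2.
Proof. exact/val_inj. Qed.

Lemma addF2K (x y : 'F_2) : x + y + y = x.
Proof. by rewrite -addrA addF2 addr0. Qed.

Lemma F2_cases (x : 'F_2) : x = 0 \/ x = 1.
Proof. by case: x => [[|[|//]]] ?; [left | right]; apply/val_inj. Qed.

Lemma oppF2 (x : 'F_2) : - x = x.
Proof. by rewrite -[LHS]addr0 -(addF2 x) addrA addNr add0r. Qed.

Lemma addF2_eq0 (x y : 'F_2) : x + y = 0 -> y = x.
Proof. by move=> xy; rewrite -[LHS]add0r -xy addF2K. Qed.

(* Cup product of the coboundaries of the vertex labels A 0, ..., A (n - 1)   *)
(* on the simplex (p 0, ..., p n).                                            *)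
Fixpoint dprod E n (A : nat -> E -> 'F_2) (p : nat -> E) : 'F_2 :=
  if n is m.+1 then
    (A 0%N (p 0%N) + A 0%N (p 1%N)) * dprod m (A \o S) (p \o S)
  else 1.

(* Cochain of degree n - 1 whose coboundary is dprod n A + dprod n B          *)
(* (dprod_transg): replace the factors dA k by dB k one at a time.            *)
Fixpoint transg E n (A B : nat -> E -> 'F_2) (p : nat -> E) : 'F_2 :=
  if n is m.+1 then
    (A 0%N (p 0%N) + B 0%N (p 0%N)) * dprod m (A \o S) p
    + (B 0%N (p 0%N) + B 0%N (p 1%N)) * transg m (A \o S) (B \o S) (p \o S)
  else 0.

Lemma bumpSS E (p : nat -> E) j : (p \o bump j.+1) \o S = (p \o S) \o bump j.
Proof. by apply/funext => i /=; rewrite bumpS. Qed.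

(** A cup product of cocycles is a cocycle. By induction the faces of index at least 2 add up to one
    term on face 0 of [p \o S], which faces 0 and 1 also contain as a factor; the three coefficients
    are the sums of [A 0] over the three pairs among p_0, p_1, p_2, so they cancel mod 2. *)
Lemma dprod_closed E n (A : nat -> E -> 'F_2) (p : nat -> E) :
  \sum_(0 <= j < n.+2) dprod n A (p \o bump j) = 0.
Proof.
elim: n A p => [|n IHn] A p.
  by rewrite !big_nat_recl// big_geq// addr0 addF2.
rewrite big_nat_recl//=.
under eq_bigr => j _ do rewrite bumpSS.
rewrite [X in _ + X]big_nat_recl//=.
have e := IHn (A \o S) (p \o S); rewrite big_nat_recl// in e.
move: e => /addF2_eq0 e.
rewrite (eq_bigr (fun i => (A 0%N (p 0%N) + A 0%N (p 1%N)) *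
   dprod n (A \o S) ((p \o S) \o bump i.+1))); last by move=> i _.
rewrite -mulr_sumr e.
have -> : (p \o bump 0) \o S = (p \o S) \o bump 0 by apply/funext.
rewrite /bump /=; set a := A _ _; set b := A _ _; set c := A _ _.
set d := dprod _ _ _.
by ring: two0.
Qed.

(** Leibniz rule: the coboundary of (A_0 + B_0) u dA_1 u ... is (dA_0 + dB_0) u dA_1 u ... by
    [dprod_closed], and that of dB_0 u [transg] is dB_0 u (dA_1 u ... + dB_1 u ...) by induction.
    The mixed terms dB_0 u dA_1 u ... cancel. *)
Lemma dprod_transg E n (A B : nat -> E -> 'F_2) (p : nat -> E) :
  dprod n A p + dprod n B p = \sum_(0 <= j < n.+1) transg n A B (p \o bump j).
Proof.
elim: n A B p => [|n IHn] A B p; first by rewrite big_nat_recl// big_geq// addF2 addr0.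
rewrite big_nat_recl//=.
under eq_bigr => j _ do rewrite bumpSS.
rewrite big_split/=.
rewrite (eq_bigr (fun i => (A 0%N (p 0%N) + B 0%N (p 0%N)) *
   dprod n (A \o S) (p \o bump i.+1))); last by move=> i _.
rewrite -mulr_sumr.
have e := dprod_closed n (A \o S) p; rewrite big_nat_recl// in e.
move: e => /addF2_eq0 ->.
(* Among these faces only the one with i = 0 moves vertex 1, to p_2; the resulting correction
   cancels the second summand of face 0. *)
have eF (F := fun j => transg n (A \o S) (B \o S) ((p \o S) \o bump j)) :
   \sum_(0 <= i < n.+1) (B 0%N (p 0%N) + B 0%N (p (bump i.+1 1))) * F i =
   (B 0%N (p 0%N) + B 0%N (p 1%N)) * \sum_(0 <= i < n.+1) F i
   + (B 0%N (p 1%N) + B 0%N (p 2%N)) * F 0%N.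
  rewrite !big_nat_recl//= mulrDr mulr_sumr addrAC -mulrDl; congr (_ * _ + _).
  by rewrite addrA addF2K.
rewrite eF -IHn.
have -> : (p \o bump 0) \o S = (p \o S) \o bump 0 by apply/funext.
have -> : p \o bump 0 = p \o S by apply/funext.
rewrite /= /bump /=.
set a0 := A _ _; set a1 := A _ _; set b0 := B _ _; set b1 := B _ _.
set b2 := B _ _.
set P := dprod _ _ _; set Q := dprod _ _ _; set t := transg _ _ _ _.
by ring: two0.
Qed.

Lemma dprodE E n (A : nat -> E -> 'F_2) (p : nat -> E) :
  dprod n A p = \prod_(k < n) (A k (p k) + A k (p k.+1)).
Proof.
elim: n A p => [|n IHn] A p; first by rewrite big_ord0.
by rewrite big_ord_recl /= IHn.
Qed.

Lemma eq_dprod E n (A : nat -> E -> 'F_2) (p q : nat -> E) :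
  (forall k, (k <= n)%N -> p k = q k) -> dprod n A p = dprod n A q.
Proof.
move=> pq; rewrite !dprodE; apply: eq_bigr => i _.
by rewrite !pq// ltnW.
Qed.

Lemma eq_transg E n (A B : nat -> E -> 'F_2) (p q : nat -> E) :
  (forall k, (k < n)%N -> p k = q k) -> transg n A B p = transg n A B q.
Proof.
elim: n A B p q => //= n IHn A B p q pq.
rewrite (@eq_dprod _ _ _ p q); last by move=> k kn; rewrite pq.
rewrite (IHn _ _ (p \o S) (q \o S)); last by move=> k kn; rewrite /= pq.
case: n {IHn} pq => [|n] pq; first by rewrite pq//= !mulr0.
by rewrite !pq.
Qed.

Lemma dprod_eq0 E n (A : nat -> E -> 'F_2) (p : nat -> E) k :
  (k < n)%N -> A k (p k) = A k (p k.+1) -> dprod n A p = 0.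
Proof.
move=> kn e; rewrite dprodE (bigD1 (Ordinal kn))//= e addF2 mul0r //.
Qed.

(** Every term of [transg] contains exactly one of the factors dA_k, dB_k or A_k + B_k, and all
    three vanish when both labels are the same constant. *)
Lemma transg_eq0 E n (A B : nat -> E -> 'F_2) (p : nat -> E) k (c : 'F_2) :
  (k < n)%N -> (forall m, (m < n)%N -> A k (p m) = c /\ B k (p m) = c) ->
  transg n A B p = 0.
Proof.
elim: n A B p k => //= n IHn A B p [|k] kn h.
  have [-> ->] := h 0%N isT; rewrite addF2 mul0r add0r.
  case: n {IHn kn} h => [|n] h; first by rewrite mulr0.
  by have [_ ->] := h 1%N isT; rewrite addF2 mul0r.
rewrite (IHn _ _ _ k)//; last by move=> m mn; apply: h.
rewrite (@dprod_eq0 _ _ _ _ k) ?mulr0 ?addr0//=.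
have [-> _] := h k (ltnW kn).
by have [-> _] := h k.+1 kn.
Qed.

Lemma dprod_shift E n (A : nat -> E -> 'F_2) (tau : E -> E) (p : nat -> E) :
  (forall k e, A k (tau e) = A k e + 1) -> dprod n A (tau \o p) = dprod n A p.
Proof.
move=> Atau; rewrite !dprodE; apply: eq_bigr => i _ /=.
by rewrite !Atau addrACA addF2 addr0.
Qed.

Lemma transg_shift E n (A B : nat -> E -> 'F_2) (tau : E -> E) (p : nat -> E) :
  (forall k e, A k (tau e) = A k e + 1) ->
  (forall k e, B k (tau e) = B k e + 1) ->
  transg n A B (tau \o p) = transg n A B p.
Proof.
elim: n A B p => //= n IHn A B p At Bt.
rewrite dprod_shift//; last by move=> k; exact: At.
have := IHn (A \o S) (B \o S) (p \o S) (fun k => At k.+1) (fun k => Bt k.+1).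
rewrite /comp /= => ->.
by rewrite At !Bt !(addrACA _ 1) addF2 !addr0.
Qed.

Definition edge I (a b : I) : 'I_2 -> I := fun i => if i == ord0 then a else b.

Lemma edgeE I (s : 'I_2 -> I) : s = edge (s ord0) (s ord_max).
Proof.
apply/funext => i; rewrite /edge; case: eqP => [->//|].
by case: i => [[|[|//]]] i2 //= ne;
  [case: ne; apply/val_inj | congr s; apply/val_inj].
Qed.

Lemma cup_expE (Y : topologicalType) (U : open_cover Y) (w : cochain U 1) n
    (s : 'I_n.+1 -> cover_index U) :
  cup_exp w n s = \prod_(k < n) w (edge (s (inord k)) (s (inord k.+1))).
Proof.
elim: n s => [|n IHn] s; first by rewrite big_ord0.
rewrite big_ord_recl /= /cup IHn; congr (_ * _).
  congr w; rewrite [LHS]edgeE; congr (edge (s _) (s _));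
    by apply/val_inj; rewrite /= inordK.
apply: eq_bigr => i _; congr (w (edge (s _) (s _)));
  apply/val_inj; rewrite /= !inordK ?lift0//= ltnS ?(leq_trans (ltn_ord i))//.
  by rewrite ltnW.
by rewrite /bump add1n ltnS ltn_ord.
Qed.

Lemma coboundary_edge (Y : topologicalType) (U : open_cover Y)
    (h : cochain U 0) (i j : cover_index U) :
  coboundary h (edge i j) = h (fun=> i) + h (fun=> j).
Proof.
rewrite /coboundary 2!big_ord_recl big_ord0 addr0 addrC.
by congr (h _ + h _); apply/funext => k /=; rewrite (ord1 k).
Qed.

Lemma nerve_edge (Y : topologicalType) (U : open_cover Y) (i j : cover_index U) y :
  U i y -> U j y -> nerve_simplex (edge i j).
Proof. by move=> Ui Uj; exists y => k _; rewrite /edge; case: ifP. Qed.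

(** * Double coverings and their characteristic cocycles *)

Section Classification.
Context {T : topologicalType} (s : T -> T).

(* The double covering T -> orbit_space s has characteristic class g: chi i   *)
(* tells apart its two sheets over W i. Only the values of chi i over W i     *)
(* are meaningful.                                                            *)
Definition classifies (W : open_cover (orbit_space s)) (g : cochain W 1)
    (chi : cover_index W -> T -> 'F_2) :=
  [/\ forall i y, W i (orbit_proj s y) -> chi i (s y) = chi i y + 1,
      forall i c, open [set y | W i (orbit_proj s y) /\ chi i y = c] &
      forall i j y, W i (orbit_proj s y) -> W j (orbit_proj s y) ->
        g (edge i j) = chi i y + chi j y].

(** A 0-cochain h whose coboundary is the difference of the two cocycles tells over which sets W_i
    the names of the two sheets have to be exchanged. *)
Lemma classifies_cohomologous (U W V : open_cover (orbit_space s))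
    (f : cochain U 1) (g : cochain V 1)
    (r : cover_index W -> cover_index U) (t : cover_index W -> cover_index V) chi :
  classifies f chi -> refinement r ->
  is_coboundary (fun z => Defs.restrict r f z - Defs.restrict t g z) ->
  exists chi', classifies (Defs.restrict t g) chi'.
Proof.
move=> [odd opn cmp] rr [h hE]; exists (fun i y => chi (r i) y + h (fun=> i)).
split.
- by move=> i y /rr Wi; rewrite odd// addrAC.
- move=> i c.
  have -> : [set y | W i (orbit_proj s y) /\ chi (r i) y + h (fun=> i) = c] =
     (orbit_proj s @^-1` W i) `&`
     [set y | U (r i) (orbit_proj s y) /\ chi (r i) y = c + h (fun=> i)].
    apply/seteqP; split => y /=; case=> Wi.
      by move=> <-; rewrite addF2K; split => //; split => //; exact: rr Wi.
    by case=> _ ->; rewrite addF2K.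
  by apply: openI => //; exact: (@cover_open _ W i).
- move=> i j y Wi Wj.
  have := hE _ (nerve_edge Wi Wj).
  rewrite coboundary_edge => e.
  have -> : Defs.restrict t g (edge i j) =
    Defs.restrict r f (edge i j) + (h (fun=> i) + h (fun=> j)).
    by rewrite -e oppF2 addrA addF2 add0r.
  have -> : Defs.restrict r f (edge i j) = f (edge (r i) (r j)).
    congr f; apply/funext => k; rewrite /= /edge; case: ifP => //.
  by rewrite (cmp _ _ y (rr _ _ Wi) (rr _ _ Wj)) addrACA.
Qed.

Lemma classifies_cocycle (W : open_cover (orbit_space s)) (g : cochain W 1) chi :
  classifies g chi -> cocycle g.
Proof.
move=> [_ _ cmp] z [q zq]; pose y := orbit_repr q.
have zy k : W (z k) (orbit_proj s y) by rewrite orbit_reprK; exact: zq.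
rewrite /coboundary; under eq_bigr => j _ do rewrite (edgeE (z \o _)) /= (cmp _ _ y)//.
rewrite 3!big_ord_recl big_ord0.
pose c m := chi (z (inord m)) y.
have cE k : chi (z k) y = c k by rewrite /c inord_val.
rewrite !cE /= /bump /=.
by ring: two0.
Qed.

(** If g vanishes, the local sheet labels agree on overlaps and glue to a locally constant odd
    function on the total space. Along a path from a point to its image it would be constant,
    because the real line is connected, and yet change by 1. *)
Lemma trivial_classifies_disconnected (R : realType) (W : open_cover (orbit_space s))
    (g : cochain W 1) chi (gam : R -> T) (b : R) :
  involutive s ->
  (forall z, nerve_simplex z -> g z = 0) -> classifies g chi ->
  continuous gam -> gam b = s (gam 0) -> False.
Proof.
move=> sK g0 [odd opn cmp] cg gb.
have same i j y : W i (orbit_proj s y) -> W j (orbit_proj s y) -> chi i y = chi j y.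
  move=> Wi Wj; apply: addF2_eq0; rewrite -(cmp j i y)// g0//.
  exact: nerve_edge Wj Wi.
have full y : exists i, W i (orbit_proj s y).
  have : (\bigcup_i W i) (orbit_proj s y) by rewrite cover_full.
  by case=> i _ Wi; exists i.
pose D c := [set x : R | exists i, W i (orbit_proj s (gam x)) /\ chi i (gam x) = c].
have Dopen c : open (D c).
  have -> : D c = \bigcup_i (gam @^-1` [set y | W i (orbit_proj s y) /\ chi i y = c]).
    by apply/seteqP; split => x /= [i]; [exists i | move=> _ h; exists i].
  by apply: bigcup_open => i _; move/continuousP : cg; apply.
have D10 : D 1 = ~` D 0.
  apply/seteqP; split => x /=.
    move=> [i [Wi c1]] [j [Wj]]; rewrite (same j i)// c1 => /eqP.
    by rewrite oner_eq0.
  move=> nD; have [i Wi] := full (gam x); exists i; split => //.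
  by case: (F2_cases (chi i (gam x))) => // c0; case: nD; exists i.
have [i W0] := full (gam 0).
have Wb : W i (orbit_proj s (gam b)).
  rewrite gb (_ : orbit_proj s _ = orbit_proj s (gam 0))//.
  by apply/orbit_projP; rewrite sK setUC.
have DT c x : D c x -> D c = setT.
  move=> Dx; have /connected_intervalP : is_interval [set: R] by [].
  apply; first by exists x.
    by exists (D c) => //; rewrite setTI.
  exists (D c); last by rewrite setTI.
  case: (F2_cases c) => ->.
    by rewrite -(setCK (D 0)) -D10; exact: open_closedC.
  by rewrite D10; exact: open_closedC.
have [j [Wj]] : D (chi i (gam 0)) b by rewrite (DT _ 0)//; exists i.
rewrite (same j i)// gb odd// => e.
have /eqP : (1 : 'F_2) = 0; last by rewrite oner_eq0.
by rewrite -[LHS]addr0 -(addF2 (chi i (gam 0))) addrA [1 + _]addrC e.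
Qed.


End Classification.

Lemma sum_continuous (R : realType) (T : topologicalType) (I : Type) (r : seq I)
    (P : pred I) (F : I -> T -> R) :
  (forall i, P i -> continuous (F i)) ->
  continuous (fun x => \sum_(i <- r | P i) F i x).
Proof.
by move=> cF; apply: (@continuous_big R I _ _ _ _ T r F cF); exact: add_continuous.
Qed.

(** * The covering of RP^oo by the infinite sphere and its generator *)

Section Sphere.
Context (R : realType).
Implicit Types p q x y : EZ2 R.

Let coord x (i : nat) : R := set_val x i.

Definition sphere_bound x : nat := projT1 (cid (set_valP x)).

Lemma sphere_bound0 x i : (sphere_bound x <= i)%N -> coord x i = 0.
Proof. by have [+ _] := projT2 (cid (set_valP x)); apply. Qed.

(** Cutting the sum at the support of the first argument leaves finitely many coordinates of y,
    whence continuity in y for coordinatewise convergence. *)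
Definition inner p y : R := \sum_(i < sphere_bound p) coord p i * coord y i.

Lemma inner_widen p y M : (sphere_bound p <= M)%N ->
  inner p y = \sum_(0 <= i < M) coord p i * coord y i.
Proof.
move=> pM; rewrite (big_cat_nat _ pM)//= [X in _ + X]big_nat_cond.
rewrite [X in _ + X]big1 ?addr0 ?big_mkord// => i.
by rewrite andbT => /andP[pi _]; rewrite sphere_bound0// mul0r.
Qed.

Lemma innerC p q : inner p q = inner q p.
Proof.
rewrite (inner_widen q (leq_maxl _ (sphere_bound q))).
rewrite (inner_widen p (leq_maxr (sphere_bound p) _)).
by apply: eq_bigr => i _; rewrite mulrC.
Qed.

Lemma innerNr p y : inner p (antipode y) = - inner p y.
Proof.
by rewrite /inner -sumrN; apply: eq_bigr => i _; rewrite /coord /= mulrN.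
Qed.

Lemma innerNl p y : inner (antipode p) y = - inner p y.
Proof. by rewrite innerC innerNr innerC. Qed.

Lemma inner_diag p : inner p p = 1.
Proof.
have [_ <-] := projT2 (cid (set_valP p)); apply: eq_bigr => i _.
by rewrite expr2.
Qed.

(* |p - q|^2 <= 2 |p - y|^2 + 2 |q - y|^2 < 2.                                 *)
Lemma inner_gt0 p q y : 3 / 4 < inner p y -> 3 / 4 < inner q y -> 0 < inner p q.
Proof.
pose M := maxn (sphere_bound p) (maxn (sphere_bound q) (sphere_bound y)).
have pM : (sphere_bound p <= M)%N by rewrite leq_maxl.
have qM : (sphere_bound q <= M)%N by rewrite /M maxnCA leq_maxl.
have yM : (sphere_bound y <= M)%N by rewrite /M maxnA leq_maxr.
move: (inner_diag p) (inner_diag q) (inner_diag y).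
rewrite !(inner_widen _ pM) !(inner_widen _ qM) !(inner_widen _ yM).
set pp := \sum_(_ <= _ < _) _; set qq := \sum_(_ <= _ < _) _.
set yy := \sum_(_ <= _ < _) _; set py := \sum_(_ <= _ < _) _.
set qy := \sum_(_ <= _ < _) _; set pq := \sum_(_ <= _ < _) _.
have : pp + qq - pq *+ 2 <=
   (pp + yy - py *+ 2) *+ 2 + (qq + yy - qy *+ 2) *+ 2.
  rewrite -!sumrMnl -!sumrN -!big_split/= -!sumrMnl -!big_split/=.
  apply: ler_sum => i _; rewrite -subr_ge0.
  set a := coord p i; set b := coord q i; set c := coord y i.
  rewrite (_ : _ - _ = (a + b - c *+ 2) ^+ 2) ?sqr_ge0//; ring.
by move=> h ep eq ey hp hq; lra.
Qed.

Lemma inner_continuous p : continuous (inner p).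
Proof.
apply: sum_continuous => i _ y; apply: (@cvgM _ _ (nbhs y)); first exact: cvg_cst.
have c1 : continuous (@set_val _ (sphere_infty (R := R))) by exact: initial_continuous.
have c2 := @proj_continuous nat (fun=> R : topologicalType) i.
exact: (continuous_comp (c1 y) (c2 _)).
Qed.

(** The two sheets over a cap are told apart by the sign of the inner product with its centre. The
    bound 3/4 is the one of [inner_gt0]: over the intersection of two caps, the sign of the inner
    product of the centres decides whether their labels agree. *)
Definition cap (p : EZ2 R) : set (RP_infty R) :=
  [set q | 3 / 4 < `|inner p (orbit_repr q)|].

Lemma capE p y : cap p (orbit_proj (@antipode R) y) <-> 3 / 4 < `|inner p y|.
Proof.
rewrite /cap /=; have /orbit_projP := orbit_reprK (orbit_proj (@antipode R) y).
set z := orbit_repr _ => e.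
have : [set y; antipode y] z by rewrite -e; left.
by case=> ->//; rewrite innerNr normrN.
Qed.

Lemma cap_open p : open (cap p).
Proof.
rewrite /open /= /quotient_open.
rewrite (_ : _ @^-1` _ = [set y | 3 / 4 < `|inner p y|]); last first.
  by apply/seteqP; split => y; [move=> /capE | move=> /= h; apply/capE].
apply: (@open_comp _ _ (fun y => `|inner p y|) [set z | 3 / 4 < z]); last exact: open_gt.
by move=> y _; apply: continuous_comp; [exact: inner_continuous | exact: norm_continuous].
Qed.

Lemma cap_full : \bigcup_p cap p = setT.
Proof.
apply/seteqP; split => // q _; exists (orbit_repr q) => //.
by rewrite /cap /= inner_diag normr1; lra.
Qed.

Definition cap_cover : open_cover (RP_infty R) := OpenCover cap_open cap_full.

Definition cap_label (p y : EZ2 R) : 'F_2 := (inner p y < 0)%R%:R.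

Definition cap_cocycle : cochain cap_cover 1 :=
  fun s => (inner (s ord0) (s ord_max) < 0)%R%:R.

Lemma cap_classifies : classifies cap_cocycle cap_label.
Proof.
have labN p y : cap p (orbit_proj (@antipode R) y) ->
    cap_label p (antipode y) = cap_label p y + 1.
  move=> /capE; rewrite /cap_label innerNr oppr_lt0.
  have [h|h|->] := ltgtP (inner p y) 0; rewrite ?addF2 ?add0r//.
  by rewrite normr0 => h; exfalso; lra.
split => //.
- move=> p c.
  case: (F2_cases c) => ->.
    rewrite (_ : [set _ | _] = inner p @^-1` [set z | 3 / 4 < z]).
      apply: open_comp; [by move=> y _; exact: inner_continuous | exact: open_gt].
    apply/seteqP; split => y /=; rewrite /cap_label.
      case=> /capE + /eqP; have [h|h] := ltP (inner p y) 0; first by [].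
      by rewrite ger0_norm.
    move=> h; split; first by apply/capE; rewrite (lt_le_trans h)// ler_norm.
    by rewrite ltNge (_ : 0 <= inner p y)//; lra.
  rewrite (_ : [set _ | _] = inner p @^-1` [set z | z < - (3 / 4)]).
    apply: open_comp; [by move=> y _; exact: inner_continuous | exact: open_lt].
  apply/seteqP; split => y /=; rewrite /cap_label.
    case=> /capE + /eqP; have [h|h] := ltP (inner p y) 0; last by [].
    by rewrite ltr0_norm//; lra.
  move=> h; have h0 : inner p y < 0 by lra.
  by split; [apply/capE; rewrite ltr0_norm//; lra | rewrite h0].
- move=> p q y /capE py /capE qy; rewrite /cap_cocycle /edge /= /cap_label.
  have [p0|p0] := ltP (inner p y) 0; have [q0|q0] := ltP (inner q y) 0.
  + rewrite addF2 ltNge ltW//; rewrite ltr0_norm// in py.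
    rewrite ltr0_norm// in qy.
    by apply: (@inner_gt0 p q (antipode y)); rewrite innerNr.
  + rewrite addr0; rewrite ltr0_norm// in py; rewrite ger0_norm// in qy.
    have : 0 < inner (antipode p) q by apply: (@inner_gt0 _ _ y); rewrite ?innerNl.
    by rewrite innerNl oppr_gt0 => ->.
  + rewrite add0r; rewrite ger0_norm// in py; rewrite ltr0_norm// in qy.
    have : 0 < inner p (antipode q) by apply: (@inner_gt0 _ _ y); rewrite ?innerNl.
    by rewrite innerNr oppr_gt0 => ->.
  + rewrite addr0; rewrite ger0_norm// in py; rewrite ger0_norm// in qy.
    by rewrite ltNge ltW//; exact: inner_gt0 py qy.
Qed.

Lemma half_turn : exists (gam : R -> EZ2 R) b,
  continuous gam /\ gam b = antipode (gam 0).
Proof.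
pose c (t : R) : prod_topology (fun _ : nat => R) :=
  fun i => match i with 0%N => cos t | 1%N => sin t | _ => 0 end.
have cS t : sphere_infty (c t).
  exists 2%N; split; first by move=> [|[|i]].
  by rewrite 2!big_ord_recl big_ord0 addr0 /= cos2Dsin2.
exists (fun t => SigSub (mem_set (cS t))), pi; split.
  apply: (@continuous_comp_initial _ _ _ set_val).
  suff : continuous c by [].
  move=> t.
  apply/cvg_sup => i.
  apply: (@continuous_comp_initial _ _ _ (@proj nat (fun=> R) i) c).
  case: i => [|[|i]]; [exact: continuous_cos|exact: continuous_sin|exact: cst_continuous].
apply/val_inj/funext => -[|[|i]] /=; rewrite ?oppr0//.
  by rewrite set_valE /= cospi cos0.
by rewrite set_valE /= sinpi sin0 oppr0.
Qed.

(** The cap cocycle is cohomologous to a multiple a of g. If a = 0 the covering would be classified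
    by a zero cocycle, which half a great circle between antipodes rules out; so a = 1 and g
    inherits the sheet labels. *)
Lemma generator_classifies (U : open_cover (RP_infty R)) (g : cochain U 1) :
  polynomial_generator g ->
  exists (W : open_cover (RP_infty R)) (t : cover_index W -> cover_index U) chi,
    refinement t /\ classifies (Defs.restrict t g) chi.
Proof.
move=> [_ gen].
have [a [[W [r [t [rr rt cob]]]] _]] :=
  gen 1%N _ _ (classifies_cocycle cap_classifies).
have [chi cl] := classifies_cohomologous cap_classifies rr cob.
case: (F2_cases a) cl => -> cl.
  have [gam [b [cg gb]]] := half_turn.
  case: (trivial_classifies_disconnected (@antipodeK R) _ cl cg gb) => z _.
  by rewrite /Defs.restrict /scale_cochain mul0r.
exists W, t, chi; split => //.
by move: cl; congr (classifies _ chi); apply/funext => z;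
  rewrite /Defs.restrict /scale_cochain mul1r /= /cup /= mulr1; congr g; 
  rewrite [RHS]edgeE [LHS]edgeE; congr (edge (t (z _)) (t (z _))); apply/val_inj.
Qed.

End Sphere.

Lemma open_prod (T T' : topologicalType) (A : set T) (B : set T') :
  open A -> open B -> open (A `*` B).
Proof.
move=> oA oB; apply: (@openI _ (fst @^-1` A) (snd @^-1` B)).
  by apply: open_comp => // z _; exact: cvg_fst.
by apply: open_comp => // z _; exact: cvg_snd.
Qed.

(** * From odd labels on X to the vanishing of w^n *)

Section Obstruction.
Context (R : realType) {X : topologicalType} (sigma : X -> X).
Hypothesis sigmaK : involutive sigma.

Let proj := orbit_proj (diag_action (R := R) sigma).
Let projR := orbit_proj (@antipode R).

Lemma orbit_proj_eq (T : topologicalType) (s : T -> T) (y z : T) :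
  orbit_proj s z = orbit_proj s y -> z = y \/ z = s y.
Proof.
move=> /orbit_projP e; have : [set z; s z] z by left.
by rewrite e => -[]; [left|right].
Qed.

Lemma orbit_proj_inv (T : topologicalType) (s : T -> T) (y : T) :
  involutive s -> orbit_proj s (s y) = orbit_proj s y.
Proof. by move=> sK; apply/orbit_projP; rewrite sK setUC. Qed.

Lemma diag_actionK : involutive (diag_action (R := R) sigma).
Proof. by case=> y e; rewrite /diag_action /= sigmaK antipodeK. Qed.

Definition twist (a : 'F_2) (x : X) := if a == 0 then x else sigma x.

Lemma twistD1 a x : twist (a + 1) x = sigma (twist a x).
Proof.
rewrite /twist; case: (F2_cases a) => ->;
  by rewrite ?add0r ?addF2 eqxx// oner_eq0 ?sigmaK.
Qed.

Section BorelCover.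
Context (N : X -> set X).
Hypothesis N_open : forall x, open (N x).
Hypothesis N_refl : forall x, N x x.
Hypothesis N_sigma : forall x y, N x y -> N (sigma x) (sigma y).
Context (W : open_cover (RP_infty R)) (c : cover_index W -> EZ2 R -> 'F_2).
Hypothesis c_odd : forall i y, W i (projR y) -> c i (antipode y) = c i y + 1.
Hypothesis c_open : forall i a, open [set y | W i (projR y) /\ c i y = a].

(* Normalizing the S^oo-component to the sheet labelled 0 makes the index     *)
(* (i, x) remember x itself and not only its orbit.                           *)
Definition borel_set (ix : cover_index W * X) : set (borel R sigma) :=
  proj @` [set z | N ix.2 z.1 /\ (W ix.1 (projR z.2) /\ c ix.1 z.2 = 0)].

(** Over W_i exactly one of z and its image under the diagonal action has label 0. Equivariance of N
    transfers the condition from that representative to z, at the price of twisting the centre x. *)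
Lemma borel_setE i x z : borel_set (i, x) (proj z) <->
  N (twist (c i z.2) x) z.1 /\ W i (projR z.2).
Proof.
have Wa e : W i (projR (antipode e)) = W i (projR e).
  by rewrite /projR (orbit_proj_inv _ (@antipodeK R)).
split=> [[z' /= [Nz' [Wz' cz']]] /orbit_proj_eq [e|e]|[]].
- by rewrite -e cz' /twist eqxx.
- move: Nz' Wz' cz'; rewrite e /= Wa => Nz Wz; rewrite c_odd// => h.
  have -> : c i z.2 = 1 by rewrite -(addF2K (c i z.2) 1) h add0r.
  by split => //; rewrite /twist oner_eq0 -(sigmaK z.1); exact: N_sigma.
- rewrite /twist; case: (F2_cases (c i z.2)) => e; rewrite e ?eqxx ?oner_eq0 => Nz Wz.
    by exists z.
  exists (diag_action sigma z); last exact: orbit_proj_inv diag_actionK.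
  by rewrite /= Wa c_odd// e addF2; split => //; rewrite -(sigmaK x); exact: N_sigma.
Qed.

Lemma borel_set_open ix : open (borel_set ix).
Proof.
case: ix => i x; rewrite /open /= /quotient_open.
rewrite (_ : _ @^-1` _ = \bigcup_(a in [set: 'F_2])
   (N (twist a x) `*` [set y | W i (projR y) /\ c i y = a])).
  apply: bigcup_open => a _; exact: open_prod.
apply/seteqP; split => z /=.
  move=> /borel_setE [Nz Wz]; exists (c i z.2) => //.
by move=> [a _ [Nz [Wz /= e]]]; apply/borel_setE; rewrite e.
Qed.

Lemma borel_set_full : \bigcup_ix borel_set ix = setT.
Proof.
apply/seteqP; split => // q _; rewrite -(orbit_reprK q).
set z := orbit_repr _.
have : (\bigcup_i W i) (projR z.2) by rewrite cover_full.
case=> i _ Wi; exists (i, twist (c i z.2) z.1) => //; apply/borel_setE; split => //.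
by rewrite /twist; case: (c i z.2 == 0); rewrite ?sigmaK; exact: N_refl.
Qed.

Definition borel_cover : open_cover (borel R sigma) :=
  OpenCover borel_set_open borel_set_full.

End BorelCover.

(** Vertices of the nerve are lifted to X x 'F_2, a centre together with a sheet label. The sheet
    labels A give w^n as [dprod n A], the labels B = chi give a product that is a coboundary by
    hypothesis, and [dprod_transg] makes the two cohomologous. The primitive is invariant under the
    deck involution [tau], so it descends to the Borel construction. *)
Lemma index_obstruction (n : nat) (N : X -> set X) (chi : nat -> X -> 'F_2)
    (v : (nat -> X) -> 'F_2) :
  index_eq R sigma n ->
  (forall x, open (N x)) -> (forall x, N x x) ->
  (forall x y, N x y -> N (sigma x) (sigma y)) ->
  (forall k x, chi k (sigma x) = chi k x + 1) ->
  (forall p q, (forall k, (k < n)%N -> p k = q k) -> v p = v q) ->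
  (forall p y, (forall k, (k <= n)%N -> N (p k) y) ->
    dprod n chi p =
    \sum_(0 <= j < n.+1) (v (p \o bump j) + v ((sigma \o p) \o bump j))) ->
  False.
Proof.
move=> [U [g [gen [nz _]]]] Nopen Nrefl Nsig chiodd vloc chiE; apply: nz.
have [W [t [c [rt [codd copen cmp]]]]] := generator_classifies gen.
pose V := borel_cover Nopen Nrefl Nsig codd copen.
pose cont := borel_to_RP_continuous (R := R) (sigma := sigma).
pose r (ix : cover_index V) : cover_index (pull_cover cont U) := t ix.1.
have rr : refinement r.
  case=> i x q; rewrite -(orbit_reprK q) => /(borel_setE Nsig codd)[_ Wi].
  by rewrite /= /preimage /= borel_to_RPE; exact: rt.
pose A (k : nat) (e : X * 'F_2) := e.2.
pose B (k : nat) (e : X * 'F_2) := chi k e.1.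
pose tau (e : X * 'F_2) := (sigma e.1, e.2 + 1).
(* [transg] passes from A to B, and the symmetrized v is the given primitive of [dprod n B]. *)
pose K (p : nat -> X * 'F_2) :=
  transg n A B p + (v (fst \o p) + v (sigma \o (fst \o p))).
have Kloc p q : (forall k, (k < n)%N -> p k = q k) -> K p = K q.
  move=> pq; congr (_ + (_ + _)); first exact: eq_transg.
    by apply: vloc => k kn /=; rewrite pq.
  by apply: vloc => k kn /=; rewrite pq.
have Ktau p : K (tau \o p) = K p.
  rewrite /K transg_shift//; last by move=> k e; exact: chiodd.
  congr (_ + _); rewrite addrC; congr (_ + _).
  by congr v; apply/funext => k /=; rewrite sigmaK.
(* lifte e lifts a simplex to X x 'F_2 along the sheet of e; lifts does so    *)
(* from the values of g alone, hence only up to tau, which K does not see.    *)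
pose lifts m (s : 'I_m.+1 -> cover_index V) k :=
  let a := g (edge (t (s ord0).1) (t (s (inord k)).1)) in
  (twist a (s (inord k)).2, a).
pose lifte (e : EZ2 R) m (s : 'I_m.+1 -> cover_index V) k :=
  let a := c (s (inord k)).1 e in (twist a (s (inord k)).2, a).
have gE m (s : 'I_m.+1 -> cover_index V) z (k l : 'I_m.+1) :
    (\bigcap_i V (s i)) (proj z) ->
    g (edge (t (s k).1) (t (s l).1)) = c (s k).1 z.2 + c (s l).1 z.2.
  move=> sz.
  have Ws h : W (s h).1 (projR z.2).
    by have := sz h I; case: (s h) => i x /(borel_setE Nsig codd)[].
  by rewrite -cmp//; congr g; apply/funext => h; rewrite /edge /=; case: ifP.
have Klift m (s : 'I_m.+1 -> cover_index V) z :
    (\bigcap_i V (s i)) (proj z) -> K (lifts m s) = K (lifte z.2 m s).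
  move=> sz; have [c0|c1] := F2_cases (c (s ord0).1 z.2).
    congr K; apply/funext => k; rewrite /lifts /= (gE _ _ _ _ _ sz) c0 add0r//.
  rewrite -Ktau; congr K; apply/funext => k.
  rewrite /lifts /= (gE _ _ _ _ _ sz) c1 addrC /tau /= addF2K twistD1 sigmaK//.
have main (s : 'I_n.+1 -> cover_index V) z : (\bigcap_i V (s i)) (proj z) ->
    cup_exp g n (fun i => t (s i).1) = \sum_(0 <= j < n.+1) K (lifte z.2 n s \o bump j).
  move=> sz; rewrite cup_expE.
  rewrite (eq_bigr (fun k : 'I_n =>
    A k (lifte z.2 n s k) + A k (lifte z.2 n s k.+1))); last first.
    by move=> k _; rewrite (gE _ _ _ _ _ sz).
  rewrite -dprodE /K big_split/= -dprod_transg.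
  have -> : dprod n B (lifte z.2 n s) = dprod n chi (fst \o lifte z.2 n s).
    by rewrite !dprodE.
  rewrite (chiE _ z.1).
    by rewrite addF2K.
  move=> k kn; have := sz (inord k) I; rewrite /lifte /=.
  by case: (s (inord k)) => i x /(borel_setE Nsig codd)[].
exists V, r, r; split => //.
have cobE s : nerve_simplex s -> exists z, (\bigcap_i V (s i)) (proj z) /\
    Defs.restrict r (cup_exp (pull_cochain cont g) n) s =
    \sum_(0 <= j < n.+1) K (lifte z.2 n s \o bump j).
  move=> [q sq]; exists (orbit_repr q).
  have sz : (\bigcap_i V (s i)) (proj (orbit_repr q)) by rewrite /proj orbit_reprK.
  by split => //; rewrite -main// /Defs.restrict !cup_expE.
case: n => [|n] in A B K vloc chiE Kloc Ktau Klift main cobE *.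
  (* In degree 0 a coboundary has to vanish. Here v depends on no point at all, so the two values of
     v cancel. *)
  move=> s /cobE [z [sz ->]].
  rewrite big_nat1 /K /= add0r.
  rewrite (vloc (fst \o _) (sigma \o (fst \o (lifte z.2 0 s \o bump 0))))//.
  by rewrite addF2 subr0.
exists (fun s => K (lifts n s)) => s /cobE [z [sz ->]].
rewrite /coboundary /zero_cochain /Defs.restrict subr0 big_mkord.
apply: eq_bigr => j _.
have szj : (\bigcap_i V ((s \o lift j) i)) (proj z) by move=> i _; exact: sz.
rewrite (Klift _ _ z szj); apply: Kloc => k kn.
rewrite /lifte /=.
have -> : lift j (inord k) = inord (bump j k).
  apply/val_inj; rewrite /= !inordK// ltnS /bump.
  exact: leq_trans (leq_add (leq_b1 _) (leqnn k)) _.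
by [].
Qed.
End Obstruction.

(** * Distance functions, uniform scales on compact sets, sign labels *)

Section RealFunctions.
Context (R : realType).

Lemma contract_continuous : continuous (@contract R).
Proof.
move=> x; apply/cvgrPdist_lt => e e0.
by have := nbhsx_ballx x e e0; apply: filterS => y.
Qed.

(** The distance to A is +oo when A is empty; composing with [contract] keeps it finite without
    changing its zeros. *)
Lemma closed_zero_set (Z : pseudoMetricType R) (A : set Z) : closed A ->
  exists d : Z -> R,
    [/\ continuous d, forall z, 0 <= d z & forall z, d z = 0 <-> A z].
Proof.
move=> cA; exists (fun z => contract (edist_inf A z)); split.
- move=> z; apply: continuous_comp; first exact: edist_inf_continuous.
  exact: contract_continuous.
- by move=> z; rewrite -(contract0 R) le_contract edist_inf_ge0.
- move=> z; split; last by move=> Az; rewrite edist_inf0// contract0.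
  move/eqP; rewrite contract_eq0 => /eqP d0; apply: cA => B /nbhs_ballP[e /= e0 zB].
  have : (edist_inf A z < e%:E)%E by rewrite d0 lte_fin.
  move=> /ereal_inf_lt[_ [a Aa <-]] /(@edist_lt_ball R Z e (z, a)) zea.
  by exists a; split => //; exact: zB.
Qed.

Lemma compact_lower_bound (Z : topologicalType) (K : set Z) I (d : I -> Z -> R) :
  compact K -> (forall i, continuous (d i)) ->
  (forall z, K z -> exists i, 0 < d i z) ->
  exists2 e, 0 < e & forall z, K z -> exists i, e <= d i z.
Proof.
move=> /compact_near_coveringP cK cd dpos.
have : \forall e \near 0^'+, K `<=` [set z | exists i, e <= d i z].
  apply: cK => z /dpos[i di].
  have h : \forall z' \near z & e \near (0:R)^'+, e < d i z / 2 /\ d i z / 2 < d i z'.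
    exists ([set z' | d i z / 2 < d i z'], [set e : R | e < d i z / 2]);
      last by move=> [z' e] [].
    split => /=; last by apply: nbhs_right_lt; rewrite divr_gt0.
    apply: (cvgr_gt (d i z)); first exact: cd.
    by rewrite ltr_pdivrMr// ltr_pMr// ltr1n.
  by apply: filterS h => -[z' e] /= [h1 h2]; exists i; rewrite ltW// (lt_trans h1).
move=> h; have [e [e0 he]] : exists e : R, 0 < e /\ K `<=` [set z | exists i, e <= d i z].
  near (0:R)^'+ => e; exists e; split; near: e => //.
  exact: nbhs_right_gt.
by exists e.
Unshelve. all: by end_near. Qed.

(** A Lebesgue number argument. At scale e some label is constant on each small simplex, which is
    what kills cup products through [dprod_eq0] and [transg_eq0]. *)
Lemma compact_sign_scale (Z : pseudoMetricType R) (K : set Z) (m : nat)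
    (h : nat -> Z -> R) :
  compact K -> (forall k, continuous (h k)) ->
  (forall z, K z -> exists2 k, (k < m)%N & h k z != 0) ->
  exists2 e, 0 < e & forall z, K z -> exists2 k, (k < m)%N &
    exists b : bool, forall z', ball z e z' -> h k z' != 0 /\ (h k z' < 0) = b.
Proof.
move=> /compact_near_coveringP cK ch h0.
pose P e z := exists2 k, (k < m)%N &
    exists b : bool, forall z', ball z e z' -> h k z' != 0 /\ (h k z' < 0) = b.
have : \forall e \near (0:R)^'+, K `<=` P e.
  apply: cK => z /h0[k km hk].
  have [b hb] : exists b, \forall z' \near z, h k z' != 0 /\ (h k z' < 0) = b.
    have [hk0|hk0] := ltP (h k z) 0.
      have hn : \forall z' \near z, h k z' < 0.
        by apply: (cvgr_lt (h k z)) => //; exact: ch.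
      by exists true; apply: filterS hn => z' h'; rewrite h' lt_eqF.
    have {}hk0 : 0 < h k z by rewrite lt_neqAle eq_sym hk.
    have hn : \forall z' \near z, 0 < h k z'.
      by apply: (cvgr_gt (h k z)) => //; exact: ch.
    by exists false; apply: filterS hn => z' h'; rewrite gt_eqF// ltNge ltW.
  move/nbhs_ballP : hb => [r /= r0 hb].
  exists (ball z (r / 2), [set e : R | e < r / 2]); last first.
    move=> [z' e] /= [zz' er]; exists k => //; exists b => z'' z'z''; apply: hb.
    by rewrite [r]splitr; exact: ball_triangle zz' (le_ball (ltW er) z'z'').
  split => /=; first by apply: nbhsx_ballx; rewrite divr_gt0.
  by apply: nbhs_right_lt; rewrite divr_gt0.
move=> h'; have [e [e0 he]] : exists e : R, 0 < e /\ K `<=` P e.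
  near (0:R)^'+ => e; exists e; split; near: e => //.
  exact: nbhs_right_gt.
by exists e.
Unshelve. all: by end_near. Qed.

(** The default c at zeros of the function lets the label be odd, or even, at every point and not
    only where the function does not vanish. *)
Definition sign_label (r : R) (c : 'F_2) : 'F_2 :=
  if r == 0 then c else (r < 0)%R%:R.

Lemma sign_labelN r c : sign_label (- r) (c + 1) = sign_label r c + 1.
Proof.
rewrite /sign_label oppr_eq0; case: eqP => [//|/eqP r0]; rewrite oppr_lt0.
by case: ltgtP r0 => //; rewrite ?addF2 ?add0r.
Qed.

End RealFunctions.

(** * Absence of odd maps from X to R^n without zeros *)

Section Odd.
Context (R : realType) (X : metricType R) (sigma : X -> X).
Hypotheses (sigma_cont : continuous sigma) (sigmaK : involutive sigma).
Hypothesis sigma_free : forall x, sigma x <> x.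
Hypothesis X_compact : compact [set: X].

(** Freeness allows one point of each orbit to be marked. The marking is not continuous and serves
    only as default at zeros. *)
Lemma odd_label : exists o : X -> 'F_2, forall x, o (sigma x) = o x + 1.
Proof.
pose rep x := orbit_repr (orbit_proj sigma x).
have repS x : rep (sigma x) = rep x by rewrite /rep orbit_proj_inv.
have repE x : rep x = x \/ rep x = sigma x.
  by apply: orbit_proj_eq; rewrite orbit_reprK.
exists (fun x => (rep x == x)%:R) => x; rewrite repS.
have [e|e] := repE x; rewrite e.
  by rewrite eqxx addF2; case: eqP => // /esym /sigma_free.
by rewrite eqxx; case: eqP => [/sigma_free//|]; rewrite add0r.
Qed.

(** The condition at sigma x makes these neighbourhoods equivariant although sigma need not be an
    isometry. *)
Definition small (e : R) (x : X) : set X :=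
  (ball x e)° `&` sigma @^-1` (ball (sigma x) e)°.

Lemma small_open e x : open (small e x).
Proof.
apply: openI; first exact: open_interior.
by apply: open_comp => [y _|]; [exact: sigma_cont|exact: open_interior].
Qed.

Lemma small_refl e x : 0 < e -> small e x x.
Proof. by move=> e0; split; exact: nbhsx_ballx. Qed.

Lemma small_sigma e x y : small e x y -> small e (sigma x) (sigma y).
Proof. by move=> [h1 h2]; split => //; rewrite /preimage /= !sigmaK. Qed.

Lemma small_ball e x y : small e x y -> ball y e x.
Proof. by move=> [/interior_subset h _]; exact: ball_sym. Qed.

Context (n : nat) (X_index : index_eq R sigma n).

(** At a small scale every simplex has a label that is constant on it, so the product of
    coboundaries is zero as a cochain and v = 0 suffices in [index_obstruction]. *)
Lemma no_odd_map (h : nat -> X -> R) :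
  (forall k, continuous (h k)) -> (forall k x, h k (sigma x) = - h k x) ->
  (forall x, exists2 k, (k < n)%N & h k x != 0) -> False.
Proof.
move=> ch oh h0; have [lab labP] := odd_label.
have [e e0 he] := compact_sign_scale X_compact ch (fun x _ => h0 x).
apply: (@index_obstruction R X sigma sigmaK n (small e)
  (fun k x => sign_label (h k x) (lab x)) (fun=> 0)) => //.
- exact: small_open.
- by move=> x; exact: small_refl.
- exact: small_sigma.
- by move=> k x; rewrite oh labP sign_labelN.
- move=> p y py; rewrite big1 => [|j _]; last by rewrite addr0.
  have [k kn [b hb]] := he y I.
  apply: (dprod_eq0 kn); rewrite /sign_label.
  case: (hb _ (small_ball (py k (ltnW kn)))) => /negPf -> ->.
  by case: (hb _ (small_ball (py k.+1 kn))) => /negPf -> ->.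
Qed.

End Odd.

(** * Absence of homotopies without zeros from odd to even functions *)

Section Homotopy.
Context (R : realType) (X : metricType R) (sigma : X -> X).
Hypotheses (sigma_cont : continuous sigma) (sigmaK : involutive sigma).
Hypothesis sigma_free : forall x, sigma x <> x.
Hypothesis X_compact : compact [set: X].
Context (n : nat) (X_index : index_eq R sigma n).

Definition cone (p : nat -> X) (k : nat) : option X :=
  if k is m.+1 then Some (p m) else None.

Lemma cone_bump p j : cone p \o bump j.+1 = cone (p \o bump j).
Proof. by apply/funext => -[|k] //=; rewrite bumpS. Qed.

Definition cone_label (chi : nat -> X -> 'F_2) (k : nat) (x : option X) : 'F_2 :=
  if x is Some y then chi k y else 0.

(* With the apex None labelled 0, the first factor of dprod on the cone is    *)
(* chi 0 itself: transfer chi = chi 0 u d chi 1 u ... u d chi n.              *)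
Definition transfer (chi : nat -> X -> 'F_2) (p : nat -> X) :=
  dprod n.+1 (cone_label chi) (cone p).

Lemma transferE chi p : transfer chi p = chi 0%N (p 0%N) * dprod n (chi \o S) p.
Proof. by rewrite /transfer /= add0r; congr (_ * _); rewrite !dprodE. Qed.

Lemma transfer_sigma_odd chi p : (forall k x, chi k (sigma x) = chi k x + 1) ->
  transfer chi p + transfer chi (sigma \o p) = dprod n (chi \o S) p.
Proof.
move=> odd; rewrite !transferE dprod_shift; last by move=> k x; exact: odd.
by rewrite -mulrDl /= odd addrA addF2 add0r mul1r.
Qed.

Lemma transfer_sigma_even chi p : (forall k x, chi k (sigma x) = chi k x) ->
  transfer chi (sigma \o p) = transfer chi p.
Proof.
move=> even; rewrite !transferE !dprodE /= even; congr (_ * _).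
by apply: eq_bigr => i _; rewrite /= !even.
Qed.

(** This is [dprod_transg] on the cone. Face 0 drops the apex and leaves p, where label k is the
    same constant for both families, so [transg_eq0] removes it; the other faces are cones over the
    faces of p. *)
Lemma transfer_step chi chi' p k c : (k < n.+1)%N ->
  (forall m, (m < n.+1)%N -> chi k (p m) = c /\ chi' k (p m) = c) ->
  transfer chi p + transfer chi' p =
  \sum_(0 <= j < n.+1)
    transg n.+1 (cone_label chi) (cone_label chi') (cone (p \o bump j)).
Proof.
move=> kn h; rewrite /transfer dprod_transg big_nat_recl//.
rewrite (@transg_eq0 _ _ _ _ _ k c)// ?add0r.
by apply: eq_bigr => j _; rewrite cone_bump.
Qed.

Lemma no_half_homotopy (H : nat -> X * R -> R) :
  (forall k, continuous (H k)) ->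
  (forall k x, H k (sigma x, 0) = - H k (x, 0)) ->
  (forall k x, H k (sigma x, 1 / 2) = H k (x, 1 / 2)) ->
  (forall x t, 0 <= t <= 1 -> exists2 k, (k < n.+1)%N & H k (x, t) != 0) -> False.
Proof.
move=> cH oddH evenH H0; have [lab labP] := odd_label sigmaK sigma_free.
pose K : set (X * R) := [set: X] `*` `[0, 1].
have cK : compact K by apply: compact_setX => //; exact: segment_compact.
have [|e e0 he] := compact_sign_scale cK cH (m := n.+1).
  by move=> [x t] [_ /=]; rewrite in_itv; exact: H0.
(* M exceeds 1/e, so the time step 1/(2M) is below e, and time 1/2 is reached at j = M. *)
pose M := (Num.truncn e^-1).+1.
pose t j : R := j%:R / (M * 2)%:R.
have M0 : 0 < (M * 2)%:R :> R by rewrite ltr0n.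
have t01 j : (j < M)%N -> 0 <= t j <= 1.
  move=> jM; rewrite /t divr_ge0//= ler_pdivrMr// mul1r ler_nat.
  by rewrite (leq_trans (ltnW jM))// leq_pmulr.
have Mn0 : M%:R != 0 :> R by rewrite pnatr_eq0.
have tS j : ball (t j) e (t j.+1).
  rewrite /ball /= -mulrBl -natr1 opprD addrA subrr sub0r mulN1r normrN.
  rewrite ger0_norm ?invr_ge0// -(invrK e) ltf_pV2 ?posrE ?invr_gt0//.
  rewrite (lt_le_trans (truncnS_gt e^-1))// ler_nat leq_pmulr//.
(* The default at zeros is odd at time 0 and constant afterwards, hence even at j = M, which is
   positive. *)
pose chi j k x := sign_label (H k (x, t j)) (if j is 0%N then lab x else 0).
have t0 : t 0%N = 0 by rewrite /t mul0r.
have tM : t M = 1 / 2 by rewrite /t natrM; field.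
have chi0 k x : chi 0%N k (sigma x) = chi 0%N k x + 1.
  by rewrite /chi t0 oddH labP sign_labelN.
have chiM k x : chi M k (sigma x) = chi M k x by rewrite /chi tM evenH.
pose v p := \sum_(j < M)
  transg n.+1 (cone_label (chi j)) (cone_label (chi j.+1)) (cone p).
have key p y : (forall k, (k <= n)%N -> small sigma e (p k) y) ->
    transfer (chi 0%N) p + transfer (chi M) p = \sum_(0 <= i < n.+1) v (p \o bump i).
  move=> py; rewrite exchange_big/=.
  have -> : transfer (chi 0%N) p + transfer (chi M) p =
      \sum_(j < M) (transfer (chi j) p + transfer (chi j.+1) p).
    have := telescope_sumr (fun j => transfer (chi j) p) (leq0n M).
    rewrite big_mkord oppF2 addrC => <-.
    by apply: eq_bigr => j _; rewrite oppF2 addrC.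
  apply: eq_bigr => j _.
  have [k kn [b hb]] := he (y, t j) (conj I (t01 j (ltn_ord j))).
  apply: (@transfer_step _ _ _ k b%:R) => // m mn.
  have ym := small_ball (py m mn).
  rewrite /chi /sign_label.
  case: (hb (p m, t j)) => [|/negPf -> ->]; first by split => //; exact: ballxx.
  by case: (hb (p m, t j.+1)) => [|/negPf -> ->]; first by split => //; exact: tS.
apply: (@index_obstruction R X sigma sigmaK n (small sigma e) (chi 0%N \o S) v) => //.
- exact: small_open.
- by move=> x; exact: small_refl.
- exact: small_sigma.
- by move=> k x /=; exact: chi0.
- move=> p q pq; apply: eq_bigr => j _; apply: eq_transg => -[|k] //= kn.
  by rewrite pq.
(* The product is u_0 + sigma u_0. By [key], at p and at sigma p, this is the coboundary of v +
   sigma v up to u_M + sigma u_M, which is 0 because the labels at time 1/2 are even. *)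
- move=> p y py; rewrite -transfer_sigma_odd// big_split/=.
  rewrite -(key p y)// -(key (sigma \o p) (sigma y)).
    rewrite (transfer_sigma_even _ (chi := chi M))//.
    by rewrite addrACA addF2 addr0.
  by move=> k kn; apply: small_sigma => //; exact: py.
Qed.
End Homotopy.

(** * Replacing the cylinder over [0, 1] by X x R *)

Section ClampedCylinder.
Context (R : realType) (X : topologicalType) (sigma : X -> X).
Hypothesis sigmaK : involutive sigma.

Lemma clamp_subproof (t : R) : `[0, 1]%classic (Num.max 0 (Num.min 1 t)).
Proof. by rewrite /= in_itv /= le_max lexx ge_max ler01 ge_min lexx. Qed.

(** Clamping pulls subsets of B(X) back to X x R, a pseudometric space on which [closed_zero_set]
    applies. *)
Definition clamp (t : R) : unit_interval R := SigSub (mem_set (clamp_subproof t)).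

Lemma clamp_continuous : continuous clamp.
Proof.
apply: (@continuous_comp_initial _ _ _ set_val).
suff : continuous (fun t : R => Num.max 0 (Num.min 1 t)) by [].
move=> t; apply: (@continuous_max R R (fun=> 0) (fun t => Num.min 1 t)).
  exact: cvg_cst.
by apply: (@continuous_min R R (fun=> 1) id) => //; exact: cvg_cst.
Qed.

Lemma flip_clamp t : flip (clamp t) = clamp (1 - t).
Proof.
apply/val_inj; rewrite /= set_valE /=.
by case: (leP 1 t) => h1; case: (leP 1 (1 - t)) => h2;
   repeat (case: leP => ?); lra.
Qed.

Lemma clamp0 : clamp 0 = zero_I R.
Proof. by apply/val_inj; rewrite /= min_r// max_l. Qed.

Definition cyl_reflect (z : X * R) : X * R := (sigma z.1, 1 - z.2).

Definition cyl_proj (z : X * R) : BX R sigma :=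
  orbit_proj (cyl_action sigma) (z.1, clamp z.2).

Lemma cyl_proj_continuous : continuous cyl_proj.
Proof.
have c1 : continuous (fun z : X * R => (z.1, clamp z.2)).
  move=> z; have c2 : continuous (clamp \o @snd X R).
    by move=> z'; apply: continuous_comp; [exact: cvg_snd|exact: clamp_continuous].
  exact: (@cvg_pair _ _ _ (nbhs z) (nbhs z.1) (nbhs (clamp z.2)) _ _ _ fst _
    cvg_fst (c2 z)).
move=> z; apply: (continuous_comp (c1 z)).
exact: pi_continuous.
Qed.

Lemma cyl_proj_reflect z : cyl_proj (cyl_reflect z) = cyl_proj z.
Proof.
rewrite /cyl_proj /cyl_reflect /= -flip_clamp.
apply: (@orbit_proj_inv _ (cyl_action sigma) (z.1, clamp z.2)).
case=> x t; rewrite /cyl_action /= sigmaK; congr (_, _).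
by apply/val_inj; exact: subKr.
Qed.

Lemma cyl_proj0 x : cyl_proj (x, 0) = iX R sigma x.
Proof. by rewrite /cyl_proj clamp0. Qed.

End ClampedCylinder.

(** * The two conclusions for closed covers *)

Section Cover.
Context (R : realType) (X : metricType R) (sigma : X -> X).
Hypotheses (sigma_cont : continuous sigma) (sigmaK : involutive sigma).
Hypothesis X_compact : compact [set: X].
Context (n : nat) (X_index : index_eq R sigma n).
Context (U : 'I_n.+2 -> set X).
Hypothesis U_closed : forall i, closed (U i).
Hypothesis U_cover : \bigcup_i U i = [set: X].
Hypothesis U_antipodal : forall i x, ~ (U i x /\ U i (sigma x)).

Lemma cover_mem x : exists i, U i x.
Proof.
have : (\bigcup_i U i) x by rewrite U_cover.
by case=> i _; exists i.
Qed.

Lemma antipodal_free x : sigma x <> x.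
Proof.
move=> e; have [i Ui] := cover_mem x.
by apply: (@U_antipodal i x); rewrite e.
Qed.

Lemma partition_point (F1 F2 : {set 'I_n.+2}) :
  F2 = (~: F1)%SET -> (0 < #|F1|)%N -> (0 < #|F2|)%N ->
  exists x : X, (forall i, i \in F1 -> U i x) /\
                (forall i, i \in F2 -> U i (sigma x)).
Proof.
move=> -> /card_gt0P[i0 i0F] /card_gt0P[j0]; rewrite inE => j0F.
apply: contrapT => nx.
have [d dP] := choice (fun i => closed_zero_set (@U_closed i)).
have dc i : continuous (d i) by have [] := dP i.
have d0 i x : 0 <= d i x by have [_ h _] := dP i.
have dU i x : d i x = 0 <-> U i x by have [_ _ h] := dP i.
have dgt i x : ~ U i x -> 0 < d i x.
  by move=> nU; rewrite lt_neqAle d0 andbT; apply/eqP => /esym /dU.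
have dsc i : continuous (d i \o sigma).
  by move=> x; apply: continuous_comp; [exact: sigma_cont|exact: dc].
pose e i := if i \in F1 then d i else d i \o sigma.
(* Without the required point, no x makes all the functions [e i] vanish; [eps] is the uniform gap
   that compactness gives. *)
have [| |eps eps0 epsP] := compact_lower_bound X_compact (d := e).
- by move=> i; rewrite /e; case: ifP.
- move=> x _; apply: contrapT => ne; apply: nx; exists x.
  by split=> i; rewrite ?inE => iF; apply: contrapT => nU; apply: ne; exists i;
    rewrite /e; [rewrite iF; exact: dgt | rewrite (negPf iF); exact: dgt].
pose g i x : R := Num.max 0 (eps - d i x).
pose f i x := g i x - g i (sigma x).
have gc i : continuous (g i).
  move=> x; apply: (@continuous_max R X (fun=> 0) (fun z => eps - d i z)).
    exact: cvg_cst.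
  by apply: cvgB; [exact: cvg_cst | exact: dc].
have fc i : continuous (f i).
  move=> x; apply: cvgB; first exact: gc.
  by apply: continuous_comp; [exact: sigma_cont|exact: gc].
have fN i x : f i (sigma x) = - f i x by rewrite /f sigmaK opprB.
have fpos x : exists i, 0 < f i x.
  have [i Ui] := cover_mem x; exists i.
  have dsx : 0 < d i (sigma x).
    by apply: dgt => Us; exact: (U_antipodal (conj Ui Us)).
  rewrite /f /g ((dU i x).2 Ui) subr0 [X in X - _]max_r ?ltW//.
  by rewrite subr_gt0 gt_max eps0/= ltrBlDr ltrDl.
have fneg x : exists i, f i x < 0.
  by have [i] := fpos (sigma x); rewrite fN oppr_gt0; exists i.
have fd i x : 0 < f i x -> d i x < eps.
  rewrite /f subr_gt0 => h; rewrite -subr_gt0.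
  have : 0 < g i x by rewrite (le_lt_trans _ h)// le_max lexx.
  by rewrite /g lt_max ltxx.
have no_pattern x : (forall i, i \in F1 -> 0 < f i x) ->
    (forall i, i \notin F1 -> f i x < 0) -> False.
  move=> f1 f2; have [i] := epsP x I; rewrite /e; case: ifPn => iF; rewrite leNgt.
    by rewrite fd//; exact: f1.
  by rewrite /= fd// fN oppr_gt0; exact: f2.
(* Removing one reference index from each block leaves n of the n + 2 indices, hence n odd
   differences. *)
pose s := enum ([set~ i0] :\ j0)%SET.
have ss : size s = n.
  have := cardsD1 j0 [set~ i0]%SET; rewrite cardsC1 card_ord !inE.
  have -> : (j0 != i0) by apply: contraNneq j0F => ->.
  by rewrite add1n => -[]; rewrite cardE.
pose h k x := let i := nth i0 s k in f i x - f (if i \in F1 then i0 else j0) x.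
apply: (no_odd_map sigma_cont sigmaK antipodal_free X_compact X_index (h := h)).
- by move=> k x; apply: cvgB; exact: fc.
- by move=> k x; rewrite /h /= !fN; ring.
move=> x; apply: contrapT => nh.
have fE i : f i x = f (if i \in F1 then i0 else j0) x.
  have [->|ni0] := eqVneq i i0; first by rewrite i0F.
  have [->|nj0] := eqVneq i j0; first by rewrite (negPf j0F).
  have si : i \in s by rewrite mem_enum !inE ni0 nj0.
  apply/eqP; rewrite -subr_eq0; apply/negPn/negP => hi; apply: nh.
  exists (index i s); last by rewrite /h nth_index.
  by have := si; rewrite -index_mem ss.
(* At a common zero f is constant on each block. As it takes both signs, the blocks have opposite
   signs, which [no_pattern] forbids at x or at sigma x. *)
have [i fi] := fpos x; have [j fj] := fneg x.
move: fi fj; rewrite fE [f j x]fE.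
case: ifP => iF; case: ifP => jF a b.
- by have := lt_trans a b; rewrite ltxx.
- by apply: (no_pattern x) => k kF; rewrite fE ?kF ?(negPf kF).
- by apply: (no_pattern (sigma x)) => k kF;
    rewrite fN fE ?oppr_gt0 ?oppr_lt0 ?kF ?(negPf kF).
- by have := lt_trans a b; rewrite ltxx.
Qed.

Lemma common_point (V : 'I_n.+2 -> set (BX R sigma)) :
  (forall i, closed (V i)) -> \bigcup_i V i = [set: BX R sigma] ->
  (forall i, U i = iX R sigma @^-1` V i) -> (\bigcap_i V i) !=set0.
Proof.
move=> Vc VT VU; apply: contrapT => nV.
pose A i : set (X * R) := cyl_proj sigma @^-1` V i.
have Ac i : closed (A i).
  by apply: closed_comp => [z _|]; [exact: cyl_proj_continuous|exact: Vc].
have [d dP] := choice (fun i => closed_zero_set (@Ac i)).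
have dc i : continuous (d i) by have [] := dP i.
have d0 i x : 0 <= d i x by have [_ h _] := dP i.
have dA i x : d i x = 0 <-> A i x by have [_ _ h] := dP i.
pose tau := @cyl_reflect R X sigma.
have tauE x t : tau (x, 1 - t) = (sigma x, t) by rewrite /tau /cyl_reflect /= subKr.
have pair_cont (f1 : X * R -> X) (f2 : X * R -> R) :
    continuous f1 -> continuous f2 -> continuous (fun z => (f1 z, f2 z)).
  move=> c1 c2 z.
  exact: (@cvg_pair _ _ _ (nbhs z) (nbhs (f1 z)) (nbhs (f2 z)) _ _ _ _ _
    (c1 z) (c2 z)).
have rc : continuous (fun z : X * R => 1 - z.2).
  by move=> z; apply: cvgB; [exact: cvg_cst|exact: cvg_snd].
have tauc : continuous tau.
  apply: pair_cont => // z.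
  by apply: continuous_comp; [exact: cvg_fst|exact: sigma_cont].
(* Symmetrizing makes D_i, and then g_i and S, invariant under [tau]: applying sigma amounts to
   exchanging t and 1 - t. *)
pose D i z := d i z + d i (tau z).
have Dc i : continuous (D i).
  move=> z; apply: cvgD; first exact: dc.
  by apply: continuous_comp; [exact: tauc|exact: dc].
have Atau i z : A i (tau z) = A i z.
  by rewrite /A /preimage /= cyl_proj_reflect.
have D0 i z : 0 <= D i z by rewrite addr_ge0.
have DA i z : D i z = 0 <-> A i z.
  split; last by move=> Az; rewrite /D (dA i z).2// (dA i (tau z)).2 ?addr0// Atau.
  by move/eqP; rewrite paddr_eq0// => /andP[/eqP /dA].
have Dtau i x t : D i (sigma x, t) = D i (x, 1 - t).
  by rewrite /D -tauE addrC /tau /cyl_reflect /= sigmaK subKr.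
pose K : set (X * R) := [set: X] `*` `[0, 1].
have Kc : compact K by apply: compact_setX => //; exact: segment_compact.
have [|eps eps0 epsP] := compact_lower_bound Kc Dc.
  move=> z _; apply: contrapT => ne; apply: nV; exists (cyl_proj sigma z) => i _.
  apply/DA/eqP/negPn/negP => Dn; apply: ne; exists i.
  by rewrite lt_neqAle D0 eq_sym Dn.
pose g i z : R := Num.max 0 (eps - D i z).
have gc i : continuous (g i).
  move=> z; apply: (@continuous_max R _ (fun=> 0) (fun z => eps - D i z)).
    exact: cvg_cst.
  by apply: cvgB; [exact: cvg_cst | exact: Dc].
have g0 i z : 0 <= g i z by rewrite le_max lexx.
have gA i z : A i z -> g i z = eps.
  by move=> /DA e; rewrite /g e subr0 max_r// ltW.
have gNA i z : ~ A i z -> g i z < eps.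
  move=> nA; rewrite gt_max eps0 ltrBlDr ltrDl lt_neqAle D0 andbT.
  by apply/eqP => /esym /DA.
have gz z : K z -> exists i, g i z = 0.
  by move=> /epsP[i ei]; exists i; rewrite /g max_l// subr_le0.
have gtau i x t : g i (sigma x, t) = g i (x, 1 - t) by rewrite /g Dtau.
pose S z := \sum_i g i z.
have Sc : continuous S by apply: sum_continuous.
have Stau x t : S (sigma x, t) = S (x, 1 - t).
  by apply: eq_bigr => i _; exact: gtau.
have S0 z : 0 < S z.
  have : (\bigcup_i V i) (cyl_proj sigma z) by rewrite VT.
  case=> i _ Vi; rewrite /S (bigD1 i)//= ltr_pwDl ?sumr_ge0//.
  by rewrite gA.
pose r (z : X * R) : X * R := (z.1, 1 - z.2).
have rcont : continuous r by apply: pair_cont => // z; exact: cvg_fst.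
pose lam (z : X * R) : R := Num.max 0 (1 - z.2 *+ 2).
have lamc : continuous lam.
  move=> z; apply: (@continuous_max R _ (fun=> 0) (fun z : X * R => 1 - z.2 *+ 2)).
    exact: cvg_cst.
  apply: cvgB; first exact: cvg_cst.
  by rewrite mulr2n; apply: cvgD; exact: cvg_snd.
(* Up to the positive factor S(z) S(r z), this is the barycentric coordinate g_i/S at z minus [lam]
   times the one at r z. As [lam] is 1 at time 0 and 0 at time 1/2, it is odd at the former and even
   at the latter. *)
pose G i z := g i z * S (r z) - lam z * g i (r z) * S z.
have Gc i : continuous (G i).
  have comp_r (f : X * R -> R) : continuous f -> continuous (f \o r).
    by move=> cf z; apply: continuous_comp; [exact: rcont|exact: cf].
  move=> z; apply: cvgB; first by apply: cvgM; [exact: gc|exact: (comp_r _ Sc)].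
  by apply: cvgM; [apply: cvgM; [exact: lamc|exact: (comp_r _ (gc i))]|exact: Sc].
pose H k z := G (inord k) z - G ord_max z.
apply: (no_half_homotopy sigma_cont sigmaK antipodal_free X_compact X_index (H := H)).
- by move=> k z; apply: cvgB; exact: Gc.
- move=> k x; rewrite /H.
  have GN i : G i (sigma x, 0) = - G i (x, 0).
    rewrite /G /r /lam /= !gtau !Stau !subr0 subrr mul0rn subr0 max_r// !mul1r.
    by rewrite opprB.
  by rewrite !GN; ring.
- move=> k x; rewrite /H.
  have GE i : G i (sigma x, 1 / 2) = G i (x, 1 / 2).
    have half : 1 - 1 / 2 = 1 / 2 :> R by field.
    rewrite /G /r /lam /= !gtau !Stau !half.
    have -> : 1 - 1 / 2 *+ 2 = 0 :> R by field.
    by rewrite maxxx !mul0r.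
  by rewrite !GE.
move=> x t t01; apply: contrapT => nH.
have GE i : G i (x, t) = G ord_max (x, t).
  have [->//|iM] := eqVneq i ord_max.
  apply/eqP; rewrite -subr_eq0; apply/negPn/negP => hi; apply: nH.
  exists i; last by rewrite /H inord_val.
  rewrite ltn_neqAle -ltnS ltn_ord andbT.
  by apply: contra iM => /eqP e; apply/eqP/val_inj.
pose a i := g i (x, t); pose b i := g i (x, 1 - t).
have [i ai] : exists i, a i = 0 by apply: gz; split => //=; rewrite in_itv.
have [j bj] : exists i, b i = 0.
  apply: gz; split => //=; rewrite in_itv /=; lra.
pose SA := S (x, t); pose SB := S (x, 1 - t).
have SA0 : 0 < SA by exact: S0.
have SB0 : 0 < SB by exact: S0.
pose l := lam (x, t).
have l0 : 0 <= l by rewrite /l /lam le_max lexx.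
have GE' k : G k (x, t) = a k * SB - l * b k * SA by [].
(* The common value of the G_k is at most 0 where a_i = 0 and at least 0 where b_j = 0, so it is
   0. *)
have G0 k : a k * SB = l * b k * SA.
  apply/eqP; rewrite -subr_eq0 -GE' eq_le; apply/andP; split.
    rewrite GE -(GE i) GE' ai mul0r sub0r oppr_le0.
    by apply: mulr_ge0; [apply: mulr_ge0 => //; exact: g0 | exact: ltW].
  rewrite GE -(GE j) GE' bj mulr0 mul0r subr0.
  by apply: mulr_ge0; [exact: g0 | exact: ltW].
(* Sum [G0] over k; a common zero can thus occur only at time 0. *)
have l1 : l = 1.
  have : SA * SB = l * (SB * SA).
    rewrite {1}/SA /S mulr_suml (eq_bigr _ (fun k _ => G0 k)) -mulr_suml -mulr_sumr.
    by rewrite mulrA.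
  move=> e; apply: (@mulIf _ (SB * SA)); first by rewrite mulf_neq0// gt_eqF.
  by rewrite -e mul1r mulrC.
have t0 : t = 0.
  move: l1; rewrite /l /lam /=; case: (leP 0 (1 - t *+ 2)) => h e; last first.
    by have := oner_neq0 R; rewrite -e eqxx.
  by apply/eqP; rewrite eq_le; apply/andP; split; lra.
have AU k y : A k (y, 0) = U k y by rewrite /A /preimage /= cyl_proj0 VU.
have A1 k : A k (x, 1 - t) = U k (sigma x).
  by rewrite -AU -Atau tauE t0.
have A0 k : A k (x, t) = U k x by rewrite t0 AU.
have [k Uk] := cover_mem x.
have [m Um] := cover_mem (sigma x).
(* At time 0, a member of the cover containing x misses sigma x, so a_k = eps > b_k and [G0] gives
   SB < SA. A member containing sigma x gives the opposite inequality. *)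
have h1 : SB < SA.
  have akE : a k = eps by apply: gA; rewrite A0.
  have bk : b k < eps by apply: gNA; rewrite A1 => Us; exact: (U_antipodal (conj Uk Us)).
  have := G0 k; rewrite l1 mul1r akE => e.
  by rewrite -(ltr_pM2l eps0) e ltr_pM2r.
have h2 : SA < SB.
  have bmE : b m = eps by apply: gA; rewrite A1.
  have am : a m < eps by apply: gNA; rewrite A0 => Us; exact: (U_antipodal (conj Us Um)).
  have := G0 m; rewrite l1 mul1r bmE => e.
  by rewrite -(ltr_pM2l eps0) -e ltr_pM2r.
by have := lt_trans h1 h2; rewrite ltxx.
Qed.

End Cover.

Theorem theorem3p8 (R : realType) (X : metricType R) (sigma : X -> X)
  (sigma_cont : continuous sigma) (sigma_inv : involutive sigma)
  (X_compact : compact [set: X])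
  (n : nat) (X_index : index_eq R sigma n)
  (U : 'I_n.+2 -> set X)
  (U_closed : forall i, closed (U i))
  (U_cover : \bigcup_i U i = [set: X])
  (U_antipodal : forall i x, ~ (U i x /\ U i (sigma x))) :
  (forall F1 F2 : {set 'I_n.+2},
     F2 = (~: F1)%SET -> (0 < #|F1|)%N -> (0 < #|F2|)%N ->
     exists x : X, (forall i, i \in F1 -> U i x) /\
                   (forall i, i \in F2 -> U i (sigma x))) /\
  (forall V : 'I_n.+2 -> set (BX R sigma),
     (forall i, closed (V i)) ->
     \bigcup_i V i = [set: BX R sigma] ->
     (forall i, U i = iX R sigma @^-1` V i) ->
     (\bigcap_i V i) !=set0).
Proof.
split=> [F1 F2|V]; first exact: partition_point.
exact: common_point.
Qed.
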